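(* For every integer $d\ge 0$, the following identities hold: (1) $E^+_d = \sum_{\delta = \alpha^1(b)^2 \in \mathrm{PCom}_E(d)} (-1)^{\ell(\alpha)} E_{\delta}$; (2) $E^+_d = \sum_{\delta = (a)^1\beta^2 \in \mathrm{PCom}_H(d)} (-1)^{\ell(\beta)} H_{\delta}$; (3) $E^+_d = \sum_{\delta = \alpha^1 \beta^2 \in \mathrm{PCom}_P(d)} (-1)^{\ell(\beta)} \dfrac{1}{Z_\alpha Z_\beta}P_{\delta}$.
   Context: A composition of $n\ge 0$ is a finite tuple $\alpha=(\alpha_1,\dots,\alpha_l)$ of positive integers with sum $|\alpha|=n$; $\ell(\alpha)=l$; the empty composition is the only composition of $0$. A polycomposition of $n$ is a sequence $\delta=(\alpha^{(1)},\alpha^{(2)},\dots)$ of (possibly empty) compositions with $\sum_{i\ge1} i|\alpha^{(i)}|=n$; write formally (not exponentiation) $\delta=(\alpha^{(1)})^1(\alpha^{(2)})^2\cdots$, omitting empty compositions. Each part $d$ of $\alpha^{(r)}$ gives a block $d^r$ of $\delta$. $\mathrm{PCom}_P(d)$ is the set of polycompositions of $d$ of the form $\alpha^1\beta^2$ with $\alpha,\beta$ (possibly empty) compositions (so $|\alpha|+2|\beta|=d$). $\mathrm{PCom}_E(d)$ is the set of polycompositions of $d$ of the form $\alpha^1(b)^2$ with $\alpha$ a (possibly empty) composition and $b$ a non-negative integer. $\mathrm{PCom}_H(d)$ is the set of polycompositions of $d$ of the form $(a)^1\beta^2$ with $\beta$ a (possibly empty) composition and $a$ a non-negative integer. In the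 last two, $b=0$ (resp. $a=0$) means the corresponding composition is empty. For a composition $\alpha=(\alpha_1,\dots,\alpha_l)$ put $Z_\alpha=\alpha_1(\alpha_1+\alpha_2)\cdots(\alpha_1+\cdots+\alpha_l)$, equal to $1$ for the empty composition. Let $x_{i,j}$ ($i,j\ge 1$) be indeterminates with $\deg x_{i,j}=i$; all series have rational coefficients. A monomial is square-free if every exponent is at most $1$. For $d\ge 0$: $H_d$ is the sum of all monomials of degree $d$; $E^+_d$ is the sum of all square-free monomials of degree $d$; $E_d$ is the sum over square-free monomials $f$ of degree $d$ of $(-1)^{m(f)}f$, where $m(f)$ is the number of indeterminates in $f$; for $d\ge 1$, $P_d=\sum_{k\mid d}\sum_{j\ge1} k\,x_{k,j}^{d/k}$. For $F\in\{H,E,P\}$ and a block $d^r$, $F_{d^r}$ is obtained from $F_d$ by replacing each $x_{i,j}$ by $x_{i,j}^r$, and $F_\delta=\prod F_{d^r}$ over all blocks $d^r$ of $\delta$ (counted with repetition; empty product $=1$). *)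

(* Defs.v *)
(* MathComp, with classical reasoning from mathcomp-classical and commutative
   monomials over an arbitrary set of indeterminates from multinomials. *)
From HB Require Import structures.
From mathcomp Require Import all_boot all_order all_algebra finmap.
From mathcomp Require Import boolp classical_sets functions cardinality fsbigop.
From mathcomp Require Import monalg.

Set Implicit Arguments.
Unset Strict Implicit.
Unset Printing Implicit Defensive.
Import Order.TTheory GRing.Theory Num.Theory.
Local Open Scope ring_scope.

Record posint := Posint { posint_val :> nat; posint_gt0 : (0 < posint_val)%N }.
HB.instance Definition _ := [isSub for posint_val].
HB.instance Definition _ := [Countable of posint by <:].

Definition one_pos : posint := @Posint 1 isT.
Definition two_pos : posint := @Posint 2 isT.

(* The pair (i, j) stands for the indeterminate x_{i,j}. *)
Definition indet := (posint * posint)%type.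

Definition monom := {cmonom indet}.

Definition wdeg (m : monom) : nat := (\sum_(x <- finsupp m) x.1 * m x)%N.

Definition squarefree (m : monom) : bool :=
  all (fun x => (m x <= 1)%N) (finsupp m).

Definition num_indet (m : monom) : nat := #|` finsupp m |.

Section Decompositions.
Local Open Scope classical_set_scope.

Definition decs (m : monom) : set (monom * monom) :=
  [set p | mmul p.1 p.2 = m].

Lemma monom_leq_finite (m : monom) :
  finite_set [set n : monom | forall x, (n x <= m x)%N].
Proof.
pose N := (\sum_(x <- finsupp m) m x)%N.
have leN x : (m x <= N)%N.
  case: (finsuppP m x) => // xm.
  by rewrite /N (big_fsetD1 x) //= leq_addr.
pose h (g : {ffun finsupp m -> 'I_N.+1}) : monom :=
  mkcmonom [fsfun y : finsupp m => nat_of_ord (g y) | 0%N].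
apply: (@sub_finite_set _ _ (h @` setT)); last first.
  exact/finite_image/finite_finset.
move=> n le_nm; exists [ffun y => inord (n (val y))] => //=.
apply/eqP/cmP => x; rewrite /h cmE.
case: (finsuppP m x) => [xNm|xm].
  rewrite fsfun_ffun insubF ?(negbTE xNm) //.
  by move: (le_nm x); rewrite (fsfun_dflt xNm) leqn0 => /eqP ->.
rewrite fsfun_ffun insubT /= ffunE inordK //.
by rewrite ltnS (leq_trans (le_nm _)) ?leN.
Qed.

Lemma decs_finite m : finite_set (decs m).
Proof.
pose D := [set n : monom | forall x, (n x <= m x)%N].
apply: (@sub_finite_set _ _ (D `*` D)); last first.
  by apply: finite_setX; exact: monom_leq_finite.
by move=> [a b] abm; split=> x /=; rewrite -abm cmM ?leq_addr ?leq_addl.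
Qed.

End Decompositions.

(* Formal power series over rat in all the x_{i,j}. *)
Record series := Series { coef : monom -> rat }.

Lemma seriesP f g : coef f =1 coef g -> f = g.
Proof. by case: f g => [f] [g] /= /funext ->. Qed.

HB.instance Definition _ := gen_eqMixin series.
HB.instance Definition _ := gen_choiceMixin series.

Definition zeros := Series (fun=> 0).
Definition adds f g := Series (fun m => coef f m + coef g m).
Definition opps f := Series (fun m => - coef f m).
Definition ones := Series (fun m => (m == mone)%:R).
Definition muls f g :=
  Series (fun m => \sum_(p \in decs m) (coef f p.1 * coef g p.2)).
Definition scales (a : rat) f := Series (fun m => a * coef f m).

Fact addsA : associative adds.
Proof. by move=> f g h; apply: seriesP => m /=; rewrite addrA. Qed.
Fact addsC : commutative adds.
Proof. by move=> f g; apply: seriesP => m /=; rewrite addrC. Qed.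
Fact add0s : left_id zeros adds.
Proof. by move=> f; apply: seriesP => m /=; rewrite add0r. Qed.
Fact addNs : left_inverse zeros opps adds.
Proof. by move=> f; apply: seriesP => m /=; rewrite addNr. Qed.

HB.instance Definition _ := GRing.isZmodule.Build series addsA addsC add0s addNs.

Lemma coef_muls f g m :
  coef (muls f g) m = \sum_(p <- fset_set (decs m)) coef f p.1 * coef g p.2.
Proof. by rewrite /= fsbig_finite //; exact: decs_finite. Qed.

Lemma mem_decs m p : (p \in fset_set (decs m)) = (mmul p.1 p.2 == m).
Proof.
rewrite in_fset_set; last exact: decs_finite.
by apply/idP/eqP => [/set_mem //|/mem_set].
Qed.

Fact mulsC : commutative muls.
Proof.
move=> f g; apply: seriesP => m; rewrite !coef_muls.
pose sw (p : monom * monom) := (p.2, p.1).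
have swK : involutive sw by case.
rewrite [RHS](perm_big (map sw (fset_set (decs m)))) ?big_map /=; last first.
  apply: uniq_perm; rewrite ?fset_uniq // ?map_inj_uniq ?fset_uniq //.
    exact: inv_inj.
  move=> p; rewrite -[p in RHS]swK mem_map; last exact: inv_inj.
  by rewrite !mem_decs /= mulmC.
by apply: eq_bigr => p _; rewrite mulrC.
Qed.

Fact mulsA : associative muls.
Proof.
move=> f g h; apply: seriesP => m; rewrite !coef_muls.
pose D n : seq (monom * monom) := fset_set (decs n).
transitivity (\sum_(t <- [seq (p.1, q.1, q.2) | p <- D m, q <- D p.2])
   coef f t.1.1 * coef g t.1.2 * coef h t.2).
  rewrite big_allpairs_dep; apply: eq_bigr => p _.
  rewrite coef_muls big_distrr /=; apply: eq_bigr => q _.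
  by rewrite mulrA.
transitivity (\sum_(t <- [seq (q.1, q.2, p.2) | p <- D m, q <- D p.1])
   coef f t.1.1 * coef g t.1.2 * coef h t.2); last first.
  rewrite big_allpairs_dep; apply: eq_bigr => p _.
  by rewrite coef_muls big_distrl.
apply: perm_big; apply: uniq_perm.
- apply: allpairs_uniq_dep => [|? _|]; rewrite ?fset_uniq //.
  move=> u v /allpairsPdep [[a b] [[c d] [_ /=]]]; rewrite mem_decs /=.
  move=> /eqP <- -> /allpairsPdep [[a' b'] [[c' d'] [_ /=]]]; rewrite mem_decs /=.
  by move=> /eqP <- -> /= [-> -> ->].
- apply: allpairs_uniq_dep => [|? _|]; rewrite ?fset_uniq //.
  move=> u v /allpairsPdep [[a b] [[c d] [_ /=]]]; rewrite mem_decs /=.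
  move=> /eqP <- -> /allpairsPdep [[a' b'] [[c' d'] [_ /=]]]; rewrite mem_decs /=.
  by move=> /eqP <- -> /= [-> -> ->].
move=> [[a b] c]; apply/allpairsPdep/allpairsPdep.
- move=> [[a' n] [[b' c'] [+ + /= [-> -> ->]]]]; rewrite !mem_decs /=.
  move=> /eqP <- /eqP <-; exists (mmul a' b', c'), (a', b').
  by rewrite !mem_decs /= mulmA !eqxx.
- move=> [[n c'] [[a' b'] [+ + /= [-> -> ->]]]]; rewrite !mem_decs /=.
  move=> /eqP <- /eqP <-; exists (a', mmul b' c'), (b', c').
  by rewrite !mem_decs /= mulmA !eqxx.
Qed.

Fact mul1s : left_id ones muls.
Proof.
move=> f; apply: seriesP => m; rewrite coef_muls.
rewrite (big_fsetD1 (mone, m)) /=; last by rewrite mem_decs /= mul1m.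
rewrite eqxx mul1r big_seq big1 ?addr0 // => -[a b].
rewrite in_fsetD1 mem_decs [_.1]/= [_.2]/= => /andP[+ /eqP abm]; case: (eqVneq a mone) => [a1|_ _].
  by rewrite -abm a1 mul1m eqxx.
by rewrite mul0r.
Qed.

Fact mulsDl : left_distributive muls adds.
Proof.
move=> f g h; apply: seriesP => m.
rewrite -[RHS]/(coef (muls f h) m + coef (muls g h) m).
by rewrite !coef_muls -big_split; apply: eq_bigr => p _; rewrite /= mulrDl.
Qed.

Fact ones_neq0 : ones != zeros.
Proof. by apply/eqP => /(congr1 (fun f => coef f mone)) /=; rewrite eqxx. Qed.

HB.instance Definition _ := GRing.Zmodule_isComNzRing.Build series
  mulsA mulsC mul1s mulsDl ones_neq0.

Fact scalesA a b f : scales a (scales b f) = scales (a * b) f.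
Proof. by apply: seriesP => m /=; rewrite mulrA. Qed.
Fact scale1s : left_id 1 scales.
Proof. by move=> f; apply: seriesP => m /=; rewrite mul1r. Qed.
Fact scalesDr : right_distributive scales +%R.
Proof. by move=> a f g; apply: seriesP => m /=; rewrite mulrDr. Qed.
Fact scalesDl f : {morph scales^~ f : a b / a + b}.
Proof. by move=> a b; apply: seriesP => m /=; rewrite mulrDl. Qed.

HB.instance Definition _ := GRing.Zmodule_isLmodule.Build rat series
  scalesA scale1s scalesDr scalesDl.

Fact scalesAl (a : rat) (f g : series) : a *: (f * g) = a *: f * g.
Proof.
apply: seriesP => m; rewrite -[LHS]/(a * coef (muls f g) m).
rewrite -[RHS]/(coef (muls (scales a f) g) m) !coef_muls.
by rewrite big_distrr /=; apply: eq_bigr => p _; rewrite /= mulrA.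
Qed.

HB.instance Definition _ := GRing.Lmodule_isLalgebra.Build rat series scalesAl.
HB.instance Definition _ := GRing.Lalgebra_isComAlgebra.Build rat series.

Definition serH (d : nat) : series := Series (fun m => (wdeg m == d)%:R).

Definition serEplus (d : nat) : series :=
  Series (fun m => (squarefree m && (wdeg m == d))%:R).

Definition serE (d : nat) : series :=
  Series (fun m => (-1) ^+ num_indet m * (squarefree m && (wdeg m == d))%:R).

Lemma expcmnE (m : monom) n x : expcmn m n x = (n * m x)%N.
Proof.
rewrite /expcmn; case: n => [|n]; first by rewrite mul0n; exact: onecmE.
rewrite [iterop _ _ _ _]/=; elim: n m => [|n IH] m; first by rewrite mul1n.
by rewrite /iterop iteriS -/(iterop _ _ _ _) mulcmE IH mulSn.
Qed.

(* The double sum over k | d and j >= 1 is a sum over the indeterminates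
   x = x_{k,j} with k | d.  For d >= 1 a given monomial m equals x^{d/k} for
   finitely many x only; the case d = 0 is not used. *)
Definition serP (d : nat) : series :=
  Series (fun m => \sum_(x \in [set x : indet | (x.1 %| d)%N]%classic)
    (if m == expcmn (ucm x) (d %/ x.1) then x.1%:R else 0 : rat)).

Lemma serP_support_finite d (m : monom) : (0 < d)%N ->
  finite_set
    [set x : indet | (x.1 %| d)%N /\ m = expcmn (ucm x) (d %/ x.1)]%classic.
Proof.
move=> d0; apply: (@sub_finite_set _ _ [set` finsupp m]%classic); last exact: finite_fset.
move=> x [xd mE] /=; rewrite mem_finsupp mE expcmnE ucmE eqxx muln1.
by rewrite -lt0n divn_gt0 ?posint_gt0 // dvdn_leq.
Qed.

(* Substitution of x_{i,j}^r for every x_{i,j}, r >= 1: the coefficient of m is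
   that of its r-th root, or 0 if m has none. *)
Definition subst_pow (r : posint) (f : series) : series :=
  Series (fun m => \sum_(n \in [set n : monom | expcmn n r = m]%classic) coef f n).

Lemma subst_pow_coef (r : posint) f n : coef (subst_pow r f) (expcmn n r) = coef f n.
Proof.
have E : ([set n' : monom | expcmn n' r = expcmn n r] = [set n])%classic.
  apply/seteqP; split=> n' /= ; last by move=> ->.
  move=> e; apply/eqP/cmP => x; move: (congr1 (fun u : monom => u x) e).
  rewrite /= !expcmnE => /eqP; rewrite eqn_pmul2l ?posint_gt0 //; exact/eqP.
by rewrite /= E fsbig_set1.
Qed.

Lemma subst_pow_coef0 (r : posint) f m :
  (forall n, expcmn n r <> m) -> coef (subst_pow r f) m = 0.
Proof.
move=> h; rewrite /= (_ : [set n' : monom | expcmn n' r = m]%classic = set0) ?fsbig_set0 //.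
by apply/seteqP; split=> n' //= /h.
Qed.
Definition composition := seq posint.

Definition csize (al : composition) : nat := (\sum_(a <- al) a)%N.

Definition Zcomp (al : composition) : nat :=
  (\prod_(i < size al) csize (take i.+1 al))%N.

(* The composition (b), which is empty when b = 0. *)
Definition single (b : nat) : composition := seq_of_opt (insub b).

(* Sequences, indexed from 1, of compositions, all but finitely many empty. *)
Definition polycomp := {fsfun posint -> composition with [::]}.

Definition pcsize (de : polycomp) : nat :=
  (\sum_(i <- finsupp de) i * csize (de i))%N.

(* alpha^1 beta^2 *)
Definition poly12 (al be : composition) : polycomp :=
  [fsfun [fsfun [fsfun] with one_pos |-> al] with two_pos |-> be].

Lemma poly12E al be i :
  poly12 al be i =
  if i == two_pos then be else if i == one_pos then al else [::].
Proof. by rewrite /poly12 !fsfun_withE fsfun0E. Qed.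

Lemma big_poly12 (R : Type) (idx : R) (op : Monoid.com_law idx)
    (F : posint -> composition -> R) al be :
    (forall i, F i [::] = idx) ->
  \big[op/idx]_(i <- finsupp (poly12 al be)) F i (poly12 al be i) =
  op (F one_pos al) (F two_pos be).
Proof.
move=> F0; set de := poly12 al be.
have sub : (finsupp de `<=` [fset one_pos; two_pos])%fset.
  apply/fsubsetP => i; rewrite mem_finsupp poly12E !inE.
  by case: (i == two_pos); case: (i == one_pos).
rewrite (big_fset_incl _ sub) /=; last first.
  by move=> i _ /fsfun_dflt ->; exact: F0.
rewrite big_fsetU1 ?inE //= big_seq_fset1.
by rewrite /de !poly12E.
Qed.

Lemma pcsize_poly12 al be : pcsize (poly12 al be) = (csize al + 2 * csize be)%N.
Proof.
rewrite /pcsize (@big_poly12 _ _ _ (fun i ga => (i * csize ga)%N)) /=.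
  by rewrite mul1n.
by move=> i; rewrite /csize big_nil muln0.
Qed.

Section PCom.
Local Open Scope classical_set_scope.

Definition PCom_P (d : nat) : set polycomp :=
  [set de | pcsize de = d /\ exists al be, de = poly12 al be].

Definition PCom_E (d : nat) : set polycomp :=
  [set de | pcsize de = d /\ exists al b, de = poly12 al (single b)].

Definition PCom_H (d : nat) : set polycomp :=
  [set de | pcsize de = d /\ exists a be, de = poly12 (single a) be].

Lemma csize_le_finite d : finite_set [set al : composition | (csize al <= d)%N].
Proof.
pose h (n : 'I_d.+1) (s : n.-tuple 'I_d.+1) : composition := pmap insub (map val s).
pose hh (u : {n : 'I_d.+1 & n.-tuple 'I_d.+1}) := h (tag u) (tagged u).
apply: (@sub_finite_set _ _ (hh @` setT)); last first.
  exact/finite_image/finite_finset.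
move=> al /= led.
have sz : (size al < d.+1)%N.
  rewrite ltnS (leq_trans _ led) // /csize -sum1_size leq_sum // => a _.
  exact: posint_gt0.
pose s := map_tuple (fun a : posint => inord a : 'I_d.+1) (in_tuple al).
exists (Tagged (fun n : 'I_d.+1 => n.-tuple 'I_d.+1) (s : (Ordinal sz).-tuple _)) => //.
rewrite /hh /h /= -map_comp.
have {led sz s} : {in al, forall a : posint, (a < d.+1)%N}.
  move=> a aal; rewrite ltnS (leq_trans _ led) // /csize.
  by rewrite (big_rem a) //= leq_addr.
elim: al => //= a al IH leal.
rewrite inordK ?leal ?mem_head // (valK a : insub (posint_val a) = _) /=.
by rewrite IH // => b bal; apply: leal; rewrite inE bal orbT.
Qed.

Lemma PCom_P_finite d : finite_set (PCom_P d).
Proof.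
pose C := [set al : composition | (csize al <= d)%N].
apply: (@sub_finite_set _ _ ((fun p => poly12 p.1 p.2) @` (C `*` C))).
  move=> de [+ [al [be deE]]]; rewrite deE pcsize_poly12 => led.
  exists (al, be) => //; split; rewrite /C /= -led ?leq_addr //.
  by rewrite (leq_trans _ (leq_addl _ _)) // leq_pmull.
by apply/finite_image/finite_setX; exact: csize_le_finite.
Qed.

Lemma PCom_E_finite d : finite_set (PCom_E d).
Proof.
apply: sub_finite_set (PCom_P_finite d) => de [deE [al [b de12]]].
by split=> //; exists al, (single b).
Qed.

Lemma PCom_H_finite d : finite_set (PCom_H d).
Proof.
apply: sub_finite_set (PCom_P_finite d) => de [deE [a [be de12]]].
by split=> //; exists (single a), be.
Qed.

End PCom.

(* F_delta *)
Definition ser_pc (F : nat -> series) (de : polycomp) : series :=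
  \prod_(r <- finsupp de) \prod_(d <- de r) subst_pow r (F d).

(* Main.v *)
(* Put H = sum_d H_d, E = sum_d E_d, E^+ = sum_d E^+_d.  These are the products
   over all indeterminates x of 1/(1 - x), 1 - x and 1 + x, so that H E = 1 and,
   since 1 + x = (1 - x^2)/(1 - x), E^+ = H E(x^2).  It remains to expand the
   factors H and E(x^2).  Inverting E (resp. H) as a geometric series gives
   the alternating sums over compositions of (1) (resp. (2)).  For (3), the
   operator multiplying the part of degree d by d sends H to P H, hence E to
   -P E; iterating the resulting Newton identities yields the weights 1/Z. *)
From HB Require Import structures.
Require Import Defs.
From mathcomp Require Import all_boot all_order all_algebra finmap.
From mathcomp Require Import boolp classical_sets functions cardinality fsbigop.
From mathcomp Require Import monalg zify ring.
Import GRing.Theory Num.Theory.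
Local Open Scope ring_scope.

(** * Compositions of a given size *)

Definition comps (n : nat) : seq composition :=
  fset_set [set al : composition | csize al = n]%classic.

Lemma mem_comps n al : (al \in comps n) = (csize al == n).
Proof.
rewrite /comps in_fset_set.
  by apply/idP/eqP => [/set_mem //|/mem_set].
by apply: (sub_finite_set _ (csize_le_finite n)) => be /= ->.
Qed.

Lemma comps_uniq n : uniq (comps n).
Proof. exact: fset_uniq. Qed.

Lemma csize_rcons al a : csize (rcons al a) = (csize al + a)%N.
Proof. by rewrite /csize -cats1 big_cat big_seq1. Qed.

Lemma csize_eq0 al : (csize al == 0%N) = (al == [::]).
Proof.
case: al => [|a al]; first by rewrite /csize big_nil eqxx.
by rewrite /csize big_cons addn_eq0 gtn_eqF ?posint_gt0.
Qed.

Lemma comps0 : comps 0 = [:: [::]].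
Proof.
apply: perm_small_eq => //; apply: uniq_perm => // [|al]; first exact: comps_uniq.
by rewrite mem_comps csize_eq0 inE.
Qed.

Definition posS (n : nat) : posint := @Posint n.+1 isT.

Lemma posS_pred (a : posint) : posS a.-1 = a.
Proof. by apply: val_inj; rewrite /= prednK ?posint_gt0. Qed.

(** The last part [i + 1] is split off, rather than the first, because the last factor of [Zcomp] is
    the whole size. The shift by one makes parts positive while indices start at 0. *)
Lemma comps_rec n :
  perm_eq (comps n.+1)
    [seq rcons al (posS i) | i <- iota 0 n.+1, al <- comps (n - i)].
Proof.
apply: uniq_perm; first exact: comps_uniq.
  apply: allpairs_uniq_dep; first exact: iota_uniq.
    by move=> i _; exact: comps_uniq.
  by move=> [i al] [j be] _ _ /= /rcons_inj[-> ->].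
move=> al; rewrite mem_comps; apply/eqP/allpairsPdep.
  elim/last_ind: al => [|al a _]; first by rewrite /csize big_nil.
  rewrite csize_rcons => aln; exists a.-1, al; rewrite posS_pred mem_iota mem_comps.
  have a0 := posint_gt0 a; rewrite /= -(prednK a0) addnS in aln.
  by case: aln => <-; rewrite ltnS leq_addl addnK eqxx.
move=> [i [be [+ + ->]]]; rewrite mem_iota mem_comps csize_rcons /= ltnS.
by move=> le_in /eqP ->; rewrite addnS subnK.
Qed.

Lemma big_comps_rec (V : nmodType) n (F : composition -> V) :
  \sum_(al <- comps n.+1) F al =
  \sum_(i < n.+1) \sum_(al <- comps (n - i)) F (rcons al (posS i)).
Proof.
rewrite (perm_big _ (comps_rec n)) big_allpairs_dep.
by rewrite -(big_mkord xpredT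
  (fun i => \sum_(al <- comps (n - i)) F (rcons al (posS i)))) /index_iota subn0.
Qed.

(** * Recursions solved by sums over compositions *)

(** Geometric series: as [f 0 = 1], the hypothesis reads [g (n+1) = - sum_i f (i+1) * g (n-i)]. Each
    unrolling appends a part [i + 1] and changes the sign. *)
Lemma inverse_comps (R : comNzRingType) (f g : nat -> R) :
    f 0 = 1 -> g 0 = 1 ->
    (forall n, \sum_(i < n.+2) f i * g (n.+1 - i)%N = 0) ->
  forall n, g n = \sum_(al <- comps n) (-1) ^+ size al * \prod_(a <- al) f a.
Proof.
move=> f0 g0 fg; elim/ltn_ind => -[_|n IH].
  by rewrite comps0 big_seq1 big_nil expr0 mulr1.
move/eqP: (fg n); rewrite big_ord_recl f0 mul1r subn0 addr_eq0 => /eqP ->.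
rewrite big_comps_rec -sumrN; apply: eq_bigr => i _.
rewrite /= subSS IH ?ltnS ?leq_subr // big_distrr /= -sumrN.
apply: eq_bigr => al _.
by rewrite size_rcons big_rcons exprSr /=; ring.
Qed.

Lemma Zcomp_rcons al a : Zcomp (rcons al a) = (Zcomp al * csize (rcons al a))%N.
Proof.
rewrite /Zcomp size_rcons big_ord_recr /=; congr muln; last first.
  by rewrite take_oversize ?size_rcons.
apply: eq_bigr => i _; rewrite -cats1 takel_cat //.
Qed.

(** Each unrolling of the recursion contributes a factor [s] and a division by the current size,
    which is exactly the factor that [Zcomp] gains when a part is appended. *)
Lemma newton_comps (A : comAlgType rat) (s : rat) (p h : nat -> A) :
    h 0 = 1 ->
    (forall n, n.+1%:R *: h n.+1 = s *: \sum_(i < n.+1) p i.+1 * h (n - i)%N) ->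
  forall n, h n =
    \sum_(al <- comps n) (s ^+ size al / (Zcomp al)%:R) *: \prod_(a <- al) p a.
Proof.
move=> h0 hS; elim/ltn_ind => -[_|n IH].
  by rewrite comps0 big_seq1 big_nil expr0 /Zcomp big_ord0 divr1 scale1r.
have n0 : n.+1%:R != 0 :> rat by rewrite pnatr_eq0.
apply: (scalerI n0); rewrite hS big_comps_rec !scaler_sumr.
apply: eq_bigr => i _; rewrite IH ?ltnS ?leq_subr // big_distrr !scaler_sumr /=.
(* Membership in [comps (n - i)] is kept, to identify [n.+1] with the last factor of [Zcomp]. *)
rewrite big_seq [RHS]big_seq; apply: eq_bigr => al.
rewrite mem_comps => /eqP alE.
have sz : csize (rcons al (posS i)) = n.+1.
  by rewrite csize_rcons alE addnS subnK // -ltnS.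
rewrite -scalerAr !scalerA Zcomp_rcons sz size_rcons big_rcons /= natrM exprS.
congr (_ *: _); last by rewrite mulrC.
by rewrite invfM [LHS]mulrC [RHS]mulrC -!mulrA mulVf ?mulr1 // [RHS]mulrC mulrA.
Qed.

(** * Sums over polycompositions *)

Lemma poly12_inj al be al' be' :
  poly12 al be = poly12 al' be' -> al = al' /\ be = be'.
Proof.
move=> e; have := congr1 (fun de : polycomp => de one_pos) e.
have := congr1 (fun de : polycomp => de two_pos) e.
by rewrite !poly12E.
Qed.

(** Groups the terms by [j], the size of [be], so that [al] has size [d - 2j]. The families [X] and
    [Y] prescribe the compositions allowed for [al] and [be]; all compositions or only [single n]
    give the three index sets of the theorem. *)
Lemma sum_poly12 (S : set polycomp) (X Y : nat -> seq composition) d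
    (V : nmodType) (G : polycomp -> V) :
    (forall n, uniq (X n)) -> (forall n, uniq (Y n)) ->
    (forall n al, al \in X n -> csize al = n) ->
    (forall n al, al \in Y n -> csize al = n) ->
    (forall de, S de <-> exists al be,
        [/\ (csize al + 2 * csize be)%N = d, al \in X (csize al),
            be \in Y (csize be) & de = poly12 al be]) ->
  \sum_(de \in S) G de =
  \sum_(j < d./2.+1) \sum_(al <- X (d - j.*2)%N) \sum_(be <- Y j) G (poly12 al be).
Proof.
move=> Xu Yu Xs Ys SE.
pose T := [seq poly12 p.1 p.2 | j <- iota 0 d./2.+1,
                       p <- [seq (al, be) | al <- X (d - j.*2)%N, be <- Y j]].
have Tu : uniq T.
  apply: allpairs_uniq_dep; first exact: iota_uniq.
    by move=> j _; apply: allpairs_uniq => // -[? ?] [].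
  move=> u v /allpairsPdep[i [p [_ + ->]]] /allpairsPdep[j [q [_ + ->]]] /=.
  move=> /allpairsP[[a b] /= [_ bi ->]] /allpairsP[[a' b'] /= [_ bj ->]].
  (* The index [j] is recovered as the size of the second composition. *)
  by move=> /poly12_inj[-> be]; rewrite -(Ys _ _ bi) -(Ys _ _ bj) be.
have ST de : S de <-> de \in T.
  rewrite SE; split=> [[al [be [dE alX beY ->]]]|/allpairsPdep[j [p [+ + ->]]]].
    apply/allpairsPdep; exists (csize be), (al, be); split=> //.
      by rewrite mem_iota add0n ltnS -dE mul2n halfD doubleK odd_double andbF
        add0n leq_addl.
    by apply/allpairsP; exists (al, be); rewrite /= -mul2n -dE addnK.
  rewrite mem_iota /= ltnS => jd /allpairsP[[al be] /= [ali bej ->]].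
  exists al, be; rewrite (Xs _ _ ali) (Ys _ _ bej) mul2n subnK //.
  by rewrite -(odd_double_half d) (leq_trans _ (leq_addl _ _)) ?leq_double.
transitivity (\sum_(de <- T) G de).
  rewrite [RHS](fsbig_seq _ _ Tu).
  by apply: eq_fsbigl; apply/seteqP; split=> de /=; rewrite ST.
rewrite big_allpairs_dep -(big_mkord xpredT (fun j =>
   \sum_(al <- X (d - j.*2)%N) \sum_(be <- Y j) G (poly12 al be))) /index_iota subn0.
apply: eq_bigr => j _.
by rewrite big_allpairs_dep.
Qed.

(** * Coefficients, and substitution of powers as an algebra morphism *)

Lemma scoefD f g m : coef (f + g) m = coef f m + coef g m.
Proof. by []. Qed.

Lemma scoef0 m : coef 0 m = 0.
Proof. by []. Qed.

Lemma scoef1 m : coef 1 m = (m == mone)%:R.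
Proof. by []. Qed.

Lemma scoefZ a (f : series) m : coef (a *: f) m = a * coef f m.
Proof. by []. Qed.

Lemma scoefM f g m :
  coef (f * g) m = \sum_(p <- fset_set (decs m)) coef f p.1 * coef g p.2.
Proof. exact: coef_muls. Qed.

Lemma scoef_sum (I : Type) (r : seq I) (F : I -> series) m :
  coef (\sum_(i <- r) F i) m = \sum_(i <- r) coef (F i) m.
Proof.
by elim: r => [|i r IH]; rewrite ?big_nil ?big_cons ?scoef0 // scoefD IH.
Qed.

Lemma expcmnM (a b : monom) r : expcmn (mmul a b) r = mmul (expcmn a r) (expcmn b r).
Proof. by apply/eqP/cmP => x; rewrite expcmnE !cmM !expcmnE mulnDr. Qed.

Lemma expcmn_inj (r : posint) : injective (fun n : monom => expcmn n r).
Proof.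
move=> a b /= e; apply/eqP/cmP => x.
have /eqP := congr1 (fun u : monom => u x) e.
by rewrite /= !expcmnE eqn_pmul2l ?posint_gt0 // => /eqP.
Qed.

Lemma expcm1n (r : posint) : expcmn (mone : monom) r = mone.
Proof. by apply/eqP/cmP => x; rewrite expcmnE !cm1 muln0. Qed.

Lemma finsupp_expcmn (n : monom) (r : posint) : finsupp (expcmn n r) = finsupp n.
Proof.
apply/fsetP => x; rewrite !mem_finsupp expcmnE muln_eq0.
by rewrite gtn_eqF ?posint_gt0.
Qed.

Lemma subst_pow_neq0 {r f m} :
  coef (subst_pow r f) m != 0 -> exists n, expcmn n r = m.
Proof.
apply: contra_neqP => nm; apply: subst_pow_coef0 => n e.
by apply: nm; exists n.
Qed.

(** Only decompositions into two [r]-th powers contribute on the right. Such products are [r]-th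
    powers, and taking roots matches them with the decompositions of the root. *)
Lemma subst_powM r f g : subst_pow r (f * g) = subst_pow r f * subst_pow r g.
Proof.
apply: seriesP => m; rewrite scoefM.
pose F p := coef (subst_pow r f) p.1 * coef (subst_pow r g) p.2.
have Fneq0 p : F p != 0 ->
    exists a b, p = (expcmn a r, expcmn b r) :> monom * monom.
  rewrite mulf_eq0 negb_or => /andP[/subst_pow_neq0[a aE] /subst_pow_neq0[b bE]].
  by exists a, b; rewrite aE bE; case: p {aE bE}.
have [[n <-{m}]|nm] := pselect (exists n, expcmn n r = m); last first.
  rewrite subst_pow_coef0 => [|n e]; last by apply: nm; exists n.
  rewrite big_seq big1 // => p; rewrite mem_decs => pm.
  apply: contra_notP nm => /eqP/Fneq0[a [b pE]]; exists (mmul a b).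
  by rewrite expcmnM; move: pm; rewrite pE => /eqP.
rewrite subst_pow_coef scoefM.
pose h (p : monom * monom) := (expcmn p.1 r, expcmn p.2 r).
have h_inj : injective h.
  by move=> [a b] [a' b'] [/expcmn_inj -> /expcmn_inj ->].
pose s := map h (fset_set (decs n)).
transitivity (\sum_(p <- s) F p).
  by rewrite big_map; apply: eq_bigr => p _; rewrite /F !subst_pow_coef.
(* Decompositions outside the image of [h] have a factor without [r]-th root and contribute 0. *)
rewrite [RHS](bigID (mem s)) /= [X in _ = _ + X]big1_seq ?addr0; last first.
  move=> p /andP[+ pn]; apply: contraNeq => /Fneq0[a [b pE]].
  move: pn; rewrite mem_decs pE /= -expcmnM => /eqP/expcmn_inj abn.
  by apply/mapP; exists (a, b); rewrite // mem_decs abn.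
rewrite -[RHS]big_filter; apply: perm_big.
apply: uniq_perm.
- by rewrite map_inj_uniq ?fset_uniq.
- exact/filter_uniq/fset_uniq.
move=> p; rewrite mem_filter; case: (boolP (p \in s)) => //= /mapP[q + ->].
by rewrite !mem_decs -expcmnM => /eqP ->; rewrite eqxx.
Qed.

Lemma subst_powD r f g : subst_pow r (f + g) = subst_pow r f + subst_pow r g.
Proof.
apply: seriesP => m; rewrite scoefD.
have [[n <-]|nm] := pselect (exists n, expcmn n r = m).
  by rewrite !subst_pow_coef.
have m0 h : coef (subst_pow r h) m = 0.
  by apply: subst_pow_coef0 => n e; apply: nm; exists n.
by rewrite !m0 addr0.
Qed.

Lemma subst_powZ r a f : subst_pow r (a *: f) = a *: subst_pow r f.
Proof.
apply: seriesP => m; rewrite scoefZ.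
have [[n <-]|nm] := pselect (exists n, expcmn n r = m).
  by rewrite !subst_pow_coef.
have m0 h : coef (subst_pow r h) m = 0.
  by apply: subst_pow_coef0 => n e; apply: nm; exists n.
by rewrite !m0 mulr0.
Qed.

Lemma subst_pow0 r : subst_pow r 0 = 0.
Proof. by rewrite -(scale0r 0) subst_powZ scale0r. Qed.

Lemma subst_pow1 r : subst_pow r 1 = 1.
Proof.
apply: seriesP => m; rewrite scoef1.
have [[n <-]|nm] := pselect (exists n, expcmn n r = m).
  by rewrite subst_pow_coef scoef1 -[in RHS](expcm1n r) (inj_eq (@expcmn_inj r)).
rewrite subst_pow_coef0 => [|n e]; last by apply: nm; exists n.
case: eqP => // m1; by case: nm; exists mone; rewrite expcm1n.
Qed.

Lemma subst_pow_one f : subst_pow one_pos f = f.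
Proof.
by apply: seriesP => m; rewrite -[m in LHS](_ : expcmn m one_pos = m) ?subst_pow_coef.
Qed.

HB.instance Definition _ r :=
  GRing.isNmodMorphism.Build series series (subst_pow r)
    (conj (subst_pow0 r) (subst_powD r)).
HB.instance Definition _ r :=
  GRing.isMonoidMorphism.Build series series (subst_pow r)
    (conj (subst_pow1 r) (subst_powM r)).
HB.instance Definition _ r :=
  GRing.isScalable.Build rat series series *:%R (subst_pow r) (subst_powZ r).

Lemma ser_pc_poly12 F al be :
  ser_pc F (poly12 al be) =
  (\prod_(a <- al) F a) * subst_pow two_pos (\prod_(b <- be) F b).
Proof.
rewrite /ser_pc (@big_poly12 _ _ _ (fun r ga => \prod_(d <- ga) subst_pow r (F d))).
  by rewrite rmorph_prod; congr (_ * _); apply: eq_bigr => a _; rewrite subst_pow_one.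
by move=> r; rewrite big_nil.
Qed.

(** * Weighted degree of monomials *)

(** Allows monomials with different supports to be compared over one common set. *)
Lemma wdeg_wide (A : {fset indet}) (m : monom) :
  (finsupp m `<=` A)%fset -> wdeg m = (\sum_(x <- A) x.1 * m x)%N.
Proof.
move=> sA; apply: big_fset_incl => // x _ /fsfun_dflt ->; exact: muln0.
Qed.

Lemma finsupp_mulcm (a b : monom) :
  finsupp (mmul a b) = (finsupp a `|` finsupp b)%fset.
Proof.
by apply/fsetP => x; rewrite inE !mem_finsupp cmM addn_eq0 negb_and.
Qed.

Lemma wdegM (a b : monom) : wdeg (mmul a b) = (wdeg a + wdeg b)%N.
Proof.
have ss := finsupp_mulcm a b.
rewrite !(@wdeg_wide (finsupp (mmul a b))) ?ss ?fsubsetUl ?fsubsetUr //.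
by rewrite -big_split; apply: eq_bigr => x _; rewrite cmM mulnDr.
Qed.

Lemma wdeg_expcmn (n : monom) (r : posint) : wdeg (expcmn n r) = (r * wdeg n)%N.
Proof.
rewrite /wdeg finsupp_expcmn big_distrr /=; apply: eq_bigr => x _.
by rewrite expcmnE mulnCA.
Qed.

Lemma wdeg_eq0 (m : monom) : (wdeg m == 0%N) = (m == mone).
Proof.
apply/eqP/eqP => [m0|->]; last first.
  by rewrite (@wdeg_wide fset0) ?big_seq_fset0 // mdom1.
apply/eqP/cmP => x; rewrite cm1; case: (finsuppP m x) => // xm.
move: m0; rewrite /wdeg (big_fsetD1 x) //= => /eqP.
rewrite addn_eq0 muln_eq0 gtn_eqF ?posint_gt0 //= => /andP[/eqP mx0 _].
by move: xm; rewrite mem_finsupp mx0.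
Qed.

(** * Euler products *)

(* The product over all indeterminates x of the series sum_n a_n x^n. *)
Definition euler (a : nat -> rat) : series :=
  Series (fun m => \prod_(x <- finsupp m) a (m x)).

Lemma coef_euler_wide a (A : {fset indet}) (m : monom) :
    a 0%N = 1 -> (finsupp m `<=` A)%fset ->
  coef (euler a) m = \prod_(x <- A) a (m x).
Proof.
by move=> a0 sA; apply: big_fset_incl => // x _ /fsfun_dflt ->.
Qed.

Lemma eq_euler a b : a =1 b -> euler a = euler b.
Proof. by move=> /funext ->. Qed.

Lemma decs_leq {m : monom} {p} x : p \in fset_set (decs m) -> (p.1 x <= m x)%N.
Proof. by rewrite mem_decs => /eqP <-; rewrite cmM leq_addr. Qed.

(** Factors are multiplied one indeterminate at a time by the Cauchy product. Distributivity turns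
    the product over [x] of these sums into a sum over choices of an exponent for each [x], that is,
    over decompositions of [m]. *)
Lemma eulerM a b : a 0%N = 1 -> b 0%N = 1 ->
  euler a * euler b = euler (fun n => \sum_(i < n.+1) a i * b (n - i)%N).
Proof.
move=> a0 b0; apply: seriesP => m; rewrite scoefM.
(* [N] bounds every exponent of [m], so that all choices of exponents live in the single finite type
   ['I_N.+1]. *)
pose A := finsupp m; pose N := (\sum_(x <- A) m x)%N.
have leN x : (m x <= N)%N.
  case: (finsuppP m x) => // xm.
  by rewrite /N (big_fsetD1 x) //= leq_addr.
have -> : coef (euler (fun n => \sum_(i < n.+1) a i * b (n - i)%N)) m =
    \prod_(x : A) \sum_(i < N.+1 | (i < (m (val x)).+1)%N)
      (a i * b (m (val x) - i)%N).
  rewrite /= [LHS]big_seq_fsetE; apply: eq_bigr => x _.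
  by rewrite (big_ord_widen N.+1 (fun i => a i * b (m (val x) - i)%N)) ?ltnS.
rewrite bigA_distr_big_dep.
pose Q := family (fun (x : A) (i : 'I_N.+1) => (i < (m (val x)).+1)%N).
pose d1 (f : {ffun A -> 'I_N.+1}) : monom :=
  mkcmonom [fsfun y : A => nat_of_ord (f y) | 0%N].
(* A choice [f] of exponents gives the first factor [d1 f]; the second is the cofactor in [m]. *)
pose h f := (d1 f, divcm m (d1 f)).
have d1E f (x : A) : d1 f (val x) = f x.
  rewrite /d1 cmE fsfun_ffun insubT /= ?fsvalP // => xA.
  by congr (nat_of_ord (f _)); exact: val_inj.
have d1out f x : x \notin A -> d1 f x = 0%N.
  by move=> xA; rewrite /d1 cmE fsfun_ffun insubF //; exact: negbTE.
have d1le f x : f \in Q -> (d1 f x <= m x)%N.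
  move=> /familyP fQ; have [xA|/d1out -> //] := boolP (x \in A).
  by have : (f [` xA]%fset < (m x).+1)%N := fQ _; rewrite -d1E.
transitivity (\sum_(p <- map h (enum Q)) coef (euler a) p.1 * coef (euler b) p.2).
  apply: perm_big; apply: uniq_perm; first exact: fset_uniq.
    rewrite map_inj_in_uniq ?enum_uniq // => f g _ _ [fg _].
    by apply/ffunP => x; apply: val_inj; rewrite /= -!d1E fg.
  move=> p; rewrite mem_decs; apply/eqP/mapP => [pm|[f + ->]]; last first.
    rewrite mem_enum => fQ /=; apply/eqP/cmP => x.
    by rewrite cmM divcmE subnKC ?d1le.
  have p1m x : (p.1 x <= m x)%N by rewrite -pm cmM leq_addr.
  pose f : {ffun A -> 'I_N.+1} := [ffun x => inord (p.1 (val x))].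
  have d1f : d1 f = p.1.
    apply/eqP/cmP => x; have [xA|xA] := boolP (x \in A).
      by rewrite (d1E f [` xA]%fset) ffunE /= inordK // ltnS (leq_trans (p1m x)).
    rewrite d1out //; apply/esym/eqP; rewrite -leqn0.
    by rewrite (leq_trans (p1m x)) // (fsfun_dflt xA).
  exists f.
    rewrite mem_enum; apply/familyP => x; rewrite unfold_in ltnS -d1E d1f; exact: p1m.
  rewrite /h d1f; case: p pm {p1m d1f f} => u v /= <-; congr pair.
  by apply/eqP/cmP => x; rewrite divcmE cmM addKn.
rewrite big_map big_enum /=.
apply: eq_bigr => f fQ; rewrite big_split /=.
have s1 : (finsupp (d1 f) `<=` A)%fset.
  by apply/fsubsetP => x; rewrite mem_finsupp; apply: contraNT => /d1out ->.
have s2 : (finsupp (divcm m (d1 f)) `<=` A)%fset.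
  apply/fsubsetP => x; rewrite !mem_finsupp divcmE; apply: contraNneq => ->.
  by rewrite sub0n.
rewrite -[LHS]/(coef (euler a) (d1 f) * coef (euler b) (divcm m (d1 f))).
rewrite (coef_euler_wide _ _ _ a0 s1) (coef_euler_wide _ _ _ b0 s2).
rewrite !big_seq_fsetE; congr (_ * _); apply: eq_bigr => x _.
  by rewrite d1E.
by rewrite divcmE d1E.
Qed.

Lemma euler_delta : euler (fun n => (n == 0%N)%:R) = 1.
Proof.
apply: seriesP => m; rewrite scoef1; case: eqP => [->|m1].
  by rewrite /= mdom1 big_seq_fset0.
have [x xm] : exists x, x \in finsupp m.
  apply: contra_notP m1 => m1; apply/eqP/cmP => x; rewrite cm1.
  by case: (finsuppP m x) => // xm; case: m1; exists x.
by rewrite /= (big_fsetD1 x) //= (negbTE (_ : m x != 0%N)) ?mul0r // -mem_finsupp.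
Qed.

(** The product of the factors [1 + s x]: the default 0 of [nth] kills any exponent above 1, and
    each indeterminate present contributes [s]. The signs -1 and 1 serve for [totE] and
    [totEplus]. *)
Lemma coef_euler_linear (s : rat) m :
  coef (euler (nth 0 [:: 1; s])) m = s ^+ num_indet m * (squarefree m)%:R.
Proof.
rewrite /= /squarefree /num_indet; case: allP => [m1|/allP nm1].
  rewrite mulr1 big_seq (eq_bigr (fun=> s)) => [|x xm].
    by rewrite -big_seq big_const_seq count_predT cardfE iter_mulr_1 -cardfE.
  by have := m1 x xm; move: xm; rewrite mem_finsupp; case: (m x) => [|[]].
rewrite mulr0; have /allPn[x xm mx] := nm1; rewrite (big_fsetD1 x) //=.
by move: mx; case: (m x) => [|[|k]] // _; rewrite nth_default ?mul0r.
Qed.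

Lemma subst_euler (r : posint) a : a 0%N = 1 ->
  subst_pow r (euler a) = euler (fun n => if (r %| n)%N then a (n %/ r)%N else 0).
Proof.
move=> a0; apply: seriesP => m.
have r0 := posint_gt0 r.
have [rm|/existsNP[x rx]] := pselect (forall x, (r %| m x)%N).
  pose n : monom := mkcmonom [fsfun y in finsupp m => (m y %/ r)%N | 0%N].
  have nE x : n x = (m x %/ r)%N.
    by rewrite cmE fsfun_fun; case: finsuppP => //; rewrite div0n.
  have -> : m = expcmn n r.
    by apply/eqP/cmP => x; rewrite expcmnE nE mulnC divnK.
  rewrite subst_pow_coef /= finsupp_expcmn; apply: eq_bigr => x _.
  by rewrite expcmnE dvdn_mulr // mulKn.
(* An exponent not divisible by [r] excludes an [r]-th root on the left and gives a zero factor on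
   the right. *)
rewrite subst_pow_coef0 => [|n nm]; last by apply: rx; rewrite -nm expcmnE dvdn_mulr.
have xm : x \in finsupp m by case: finsuppP rx => // _ []; rewrite dvdn0.
by rewrite /= (big_fsetD1 x) //= (negbTE (introN idP rx)) mul0r.
Qed.

(** * The generating series of H, E and E^+ *)

Definition totH := euler (fun=> 1).
Definition totE := euler (nth 0 [:: 1; -1]).
Definition totEplus := euler (nth 0 [:: 1; 1]).

Lemma mul_totH_totE : totH * totE = 1.
Proof.
rewrite /totH /totE eulerM // -euler_delta; apply: eq_euler => n.
(* After reversal the coefficient is a partial sum of 1, -1, 0, 0, ...: it is 1 for [n = 0] and 0
   afterwards. *)
rewrite (reindex_inj rev_ord_inj) /=.
transitivity (\sum_(i < n.+1) [:: 1; -1]`_i : rat).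
  by apply: eq_bigr => i _; rewrite mul1r subSS subKn // -ltnS.
case: n => [|n]; rewrite !big_ord_recl ?big_ord0 //= big1 => [|i _].
  by rewrite addr0 subrr.
by rewrite nth_default.
Qed.

Lemma mul_totH_subst_totE : totH * subst_pow two_pos totE = totEplus.
Proof.
rewrite /totH /totE subst_euler // eulerM //; apply: eq_euler => n.
(* The coefficients are now partial sums of those of [1 - x^2], namely 1, 1, 0, 0, ... *)
rewrite (reindex_inj rev_ord_inj) /=.
transitivity (\sum_(i < n.+1)
    (if (2 %| i)%N then [:: 1; -1]`_(i %/ 2) else 0 : rat)).
  by apply: eq_bigr => i _; rewrite mul1r subSS subKn // -ltnS.
case: n => [|[|n]]; rewrite ?big_ord_recl ?big_ord0 //= big1 ?addr0 // => [|i _].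
  by rewrite nth_nil add0r subrr.
(* The remaining indices are at least 3; half of an even one is at least 2, past the end of the
   list. *)
rewrite /bump /=; case: ifP => // i2; rewrite nth_default //=; lia.
Qed.

(** * Homogeneous parts and convolution identities *)

Definition hpart (d : nat) (f : series) : series :=
  Series (fun m => (wdeg m == d)%:R * coef f m).

(** Degree is additive, so a decomposition of a monomial of degree [d] is counted only at [i] equal
    to the degree of its first factor. *)
Lemma hpartM d f g : hpart d (f * g) = \sum_(i < d.+1) hpart i f * hpart (d - i) g.
Proof.
apply: seriesP => m; rewrite scoef_sum.
under [RHS]eq_bigr => i _ do rewrite scoefM.
rewrite exchange_big -[LHS]/(_ * coef (f * g) m) scoefM big_distrr /=.
rewrite big_seq [RHS]big_seq; apply: eq_bigr => p; rewrite mem_decs => /eqP <-.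
rewrite wdegM; case: eqP => [<-|pd].
  have pl : (wdeg p.1 < (wdeg p.1 + wdeg p.2).+1)%N by rewrite ltnS leq_addr.
  rewrite (bigD1 (Ordinal pl)) //= addKn !eqxx !mul1r big1 ?addr0 // => i.
  rewrite -val_eqE eq_sym /= => /negbTE ->; by rewrite !mul0r.
rewrite mul0r big1 // => i _; case: eqP => [pi|]; last by rewrite !mul0r.
case: eqP => [pi'|]; last by rewrite mul0r mulr0.
by case: pd; rewrite pi pi' subnKC // -ltnS.
Qed.

Lemma hpart_totH d : hpart d totH = serH d.
Proof. by apply: seriesP => m /=; rewrite big1 ?mulr1. Qed.

Lemma hpart_totE d : hpart d totE = serE d.
Proof.
apply: seriesP => m; rewrite -[LHS]/(_ * coef totE m) coef_euler_linear /=.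
by rewrite andbC -mulnb natrM mulrCA.
Qed.

Lemma hpart_totEplus d : hpart d totEplus = serEplus d.
Proof.
apply: seriesP => m; rewrite -[LHS]/(_ * coef totEplus m) coef_euler_linear /=.
by rewrite expr1n mul1r andbC -mulnb natrM.
Qed.

Lemma hpart1 d : hpart d 1 = (d == 0%N)%:R.
Proof.
apply: seriesP => m; rewrite -[LHS]/(_ * coef 1 m) scoef1 -wdeg_eq0.
case: (eqVneq d 0%N) => [->|d0]; rewrite ?scoef1 -?wdeg_eq0 ?scoef0.
  by case: eqP; rewrite ?mul1r ?mul0r.
by case: eqP => [->|_]; rewrite ?(negbTE d0) ?mulr0 ?mul0r.
Qed.

Lemma hpart_subst d (r : posint) f :
  hpart d (subst_pow r f) = if (r %| d)%N then subst_pow r (hpart (d %/ r) f) else 0.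
Proof.
have r0 := posint_gt0 r.
apply: seriesP => m; rewrite -[LHS]/(_ * coef (subst_pow r f) m).
have [[n <-]|nm] := pselect (exists n, expcmn n r = m); last first.
  have z h : coef (subst_pow r h) m = 0.
    by apply: subst_pow_coef0 => n e; apply: nm; exists n.
  by rewrite z mulr0; case: ifP; rewrite ?z ?scoef0.
rewrite wdeg_expcmn subst_pow_coef; case: ifP => rd.
  rewrite subst_pow_coef /=; congr (_%:R * _).
  by rewrite -[in LHS](divnK rd) [in LHS]mulnC eqn_pmul2r.
case: eqP => [nd|_]; last by rewrite mul0r scoef0.
by rewrite -nd dvdn_mulr in rd.
Qed.

Lemma sum_even (V : nmodType) (F : nat -> V) d :
    (forall i, odd i -> F i = 0) ->
  \sum_(i < d.+1) F i = \sum_(j < d./2.+1) F j.*2.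
Proof.
move=> F0; elim: d => [|d IH]; first by rewrite !big_ord1.
rewrite big_ord_recr IH /= uphalf_half; case: (boolP (odd d)) => od.
  rewrite add1n [RHS]big_ord_recr /= (_ : d./2.+1.*2 = d.+1) //.
  by rewrite doubleS -[in RHS](odd_double_half d) od.
by rewrite add0n F0 ?addr0 //= od.
Qed.

(** Common source of the three identities: the part of degree [d] of [E^+ = H E(x^2)], where
    [E(x^2)] lives in even degrees [2j]. *)
Lemma serEplus_conv d : serEplus d =
  \sum_(j < d./2.+1) serH (d - j.*2) * subst_pow two_pos (serE j).
Proof.
rewrite -hpart_totEplus -mul_totH_subst_totE mulrC hpartM.
rewrite (sum_even _ (fun i => hpart i (subst_pow two_pos totE) * hpart (d - i) totH)).
  apply: eq_bigr => j _.
  by rewrite hpart_subst -muln2 dvdn_mull // mulnK // hpart_totE hpart_totH mulrC.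
by move=> i oi; rewrite hpart_subst dvdn2 oi mul0r.
Qed.

Lemma serE_conv_serH n : \sum_(i < n.+2) serE i * serH (n.+1 - i) = 0.
Proof.
rewrite -[RHS](hpart1 n.+1) -mul_totH_totE mulrC hpartM; apply: eq_bigr => i _.
by rewrite hpart_totE hpart_totH.
Qed.

Lemma serH0 : serH 0 = 1.
Proof.
by apply: seriesP => m; rewrite scoef1 /= wdeg_eq0.
Qed.

Lemma serE0 : serE 0 = 1.
Proof.
have := hpartM 0 totH totE; rewrite mul_totH_totE hpart1 big_ord1 hpart_totH serH0 mul1r.
by rewrite hpart_totE.
Qed.

(** * Logarithmic derivatives and Newton identities *)

(* The weighted Euler operator, t d/dt when t records the degree. *)
Definition wder (f : series) : series :=
  Series (fun m => (wdeg m)%:R * coef f m).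

Lemma wderM f g : wder (f * g) = wder f * g + f * wder g.
Proof.
apply: seriesP => m; rewrite -[LHS]/(_ * coef (f * g) m) scoefD !scoefM.
rewrite -big_split big_distrr big_seq [RHS]big_seq; apply: eq_bigr => p.
by rewrite mem_decs => /eqP <-; rewrite wdegM natrD /=; ring.
Qed.

Lemma wder1 : wder 1 = 0.
Proof.
apply: seriesP => m; rewrite -[LHS]/(_ * coef 1 m) scoef0 scoef1 -wdeg_eq0.
by case: eqP => [->|]; rewrite ?mul0r ?mulr0.
Qed.

Lemma hpart_wder d f : hpart d (wder f) = d%:R *: hpart d f.
Proof.
apply: seriesP => m; rewrite scoefZ /=; case: eqP => [->|_]; first by ring.
by rewrite !mul0r mulr0.
Qed.

(** The sum of all [serP d] with [d >= 1]. For [x] in the support, the test says that [m] is a pure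
    power of [x], so that no degree has to be fixed. *)
Definition totP : series :=
  Series (fun m => \sum_(x <- finsupp m)
    if m == expcmn (ucm x) (m x) then x.1%:R else 0 : rat).

Lemma expcmn_ucm (x y : indet) n : expcmn (ucm x) n y = (n * (x == y))%N.
Proof. by rewrite expcmnE ucmE. Qed.

Lemma wdeg_expcmn_ucm (x : indet) n : wdeg (expcmn (ucm x) n) = (x.1 * n)%N.
Proof.
rewrite (@wdeg_wide [fset x]%fset) ?big_seq_fset1 ?expcmn_ucm ?eqxx ?muln1 //.
apply/fsubsetP => y; rewrite mem_finsupp expcmn_ucm inE.
by apply: contraNT; rewrite eq_sym => /negbTE ->; rewrite muln0.
Qed.

Lemma eq_pow_indet d m (x : indet) : (0 < d)%N ->
  (x.1 %| d)%N && (m == expcmn (ucm x) (d %/ x.1)) =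
  (wdeg m == d) && (m == expcmn (ucm x) (m x)).
Proof.
have x0 := posint_gt0 x.1.
move=> d0; apply/andP/andP => [[xd /eqP mE]|[/eqP <- /eqP]].
  by rewrite mE wdeg_expcmn_ucm mulnC divnK // expcmn_ucm !eqxx muln1.
by move: (m x) => k ->; rewrite wdeg_expcmn_ucm dvdn_mulr ?mulKn.
Qed.

Lemma hpart_totP d : (0 < d)%N -> hpart d totP = serP d.
Proof.
move=> d0; apply: seriesP => m.
pose g (x : indet) : rat :=
  if (x.1 %| d)%N && (m == expcmn (ucm x) (d %/ x.1)) then x.1%:R else 0.
transitivity (\sum_(x <- finsupp m) g x).
  rewrite /= big_distrr; apply: eq_bigr => x _; rewrite /g eq_pow_indet //=.
  by case: eqP; rewrite ?mul1r ?mul0r.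
(* Both sums are compared through the sum of [g] over all indeterminates, since [g] vanishes off
   either index set. *)
rewrite fsbig_seq ?fset_uniq //= (fsbig_widen _ setT) //; last first.
  move=> x [_ /=]; rewrite /g => xm; case: ifP => // /andP[xd /eqP mE].
  case: xm; rewrite mem_finsupp mE expcmn_ucm eqxx muln1 -lt0n divn_gt0 ?posint_gt0 //.
  exact: dvdn_leq.
rewrite -(fsbig_widen [set x : indet | (x.1 %| d)%N]%classic setT) //.
  by apply: eq_fsbigr => x /set_mem /= xd; rewrite /g xd.
by move=> x [_ /= /negP/negbTE xd]; rewrite /g xd.
Qed.

Lemma hpart0_totP : hpart 0 totP = 0.
Proof.
apply: seriesP => m; rewrite scoef0 /= wdeg_eq0; case: eqP => [->|_].
  by rewrite mdom1 big_seq_fset0 mulr0.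
by rewrite mul0r.
Qed.

(** Double counting: the coefficient of [m] in [totP * totH] adds the weight of [x] once for each
    power [x^k] dividing [m] with [k >= 1]. Each [x] thus counts [m x] times, and the total is
    [wdeg m]. *)
Lemma wder_totH : wder totH = totP * totH.
Proof.
apply: seriesP => m; rewrite scoefM.
have H1 n : coef totH n = 1 by rewrite /= big1.
rewrite -[LHS]/(_ * coef totH m) H1 mulr1.
transitivity (\sum_(p <- fset_set (decs m)) \sum_(x <- finsupp m)
   \sum_(e < m x) (if p.1 == expcmn (ucm x) e.+1 then x.1%:R else 0 : rat)).
  (* For fixed [x] and [e], exactly one decomposition has first factor [x^(e+1)]. *)
  rewrite exchange_big /wdeg natr_sum; apply: eq_bigr => x _.
  rewrite exchange_big natrM mulr_natr -[m x in LHS]card_ord -sumr_const.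
  apply: eq_bigr => e _.
  have le y : (expcmn (ucm x) e.+1 y <= m y)%N.
    by rewrite expcmn_ucm; case: eqP => [<-|]; rewrite ?muln0 ?muln1.
  move: e.+1 le => k le.
  pose q : monom * monom := (expcmn (ucm x) k, divcm m (expcmn (ucm x) k)).
  have qm : q \in fset_set (decs m).
    by rewrite mem_decs; apply/eqP/eqP/cmP => y; rewrite cmM divcmE subnKC.
  rewrite (big_fsetD1 q) //= eqxx big_seq big1 ?addr0 // => -[a b].
  rewrite in_fsetD1 mem_decs /= => /andP[+ /eqP ab]; apply: contraNeq.
  case: ifP => [/eqP aE _|_]; last by rewrite eqxx.
  rewrite /q -aE -ab; apply/eqP; congr pair; apply/eqP/cmP => y.
  by rewrite divcmE cmM addKn.
rewrite big_seq [RHS]big_seq; apply: eq_bigr => p pm; rewrite H1 mulr1.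
have ple x : (p.1 x <= m x)%N := decs_leq x pm.
have sub : (finsupp p.1 `<=` finsupp m)%fset.
  apply/fsubsetP => x; rewrite !mem_finsupp -!lt0n => px.
  exact: leq_trans px (ple x).
rewrite [RHS]/= -(big_fset_incl _ sub) => [|x _ xp]; last first.
  rewrite big1 // => e _; case: eqP => // pE.
  by move: xp; rewrite mem_finsupp pE expcmn_ucm eqxx.
rewrite big_seq [RHS]big_seq; apply: eq_bigr => x; rewrite mem_finsupp => px.
(* Conversely, for fixed [p] and [x], only [e = p.1 x - 1] can match. *)
have xm : ((p.1 x).-1 < m x)%N by rewrite prednK ?lt0n.
rewrite (bigD1 (Ordinal xm)) // [nat_of_ord (Ordinal _)]/= prednK ?lt0n //.
rewrite big1 => [|e]; first exact: addr0.
rewrite -val_eqE; apply: contraNeq; case: ifP => [/eqP pE _|_]; last by rewrite eqxx.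
by rewrite [val (Ordinal _)]/= pE expcmn_ucm eqxx muln1.
Qed.

(** Differentiating [H E = 1] gives [H * wder E = - P]; multiplying by [E] isolates [wder E]. *)
Lemma wder_totE : wder totE = - (totP * totE).
Proof.
have H : wder totH * totE + totH * wder totE = 0.
  by rewrite -wderM mul_totH_totE wder1.
move: H; rewrite wder_totH -mulrA mul_totH_totE mulr1.
move=> /(congr1 ( *%R totE)); rewrite mulr0 mulrDr mulrA (mulrC totE totH).
rewrite mul_totH_totE mul1r => /eqP; rewrite addrC addr_eq0 => /eqP ->.
by rewrite mulrC.
Qed.

(* Comparing the parts of degree n+1 in wder f = s P f gives Newton's identities. *)
Lemma hpart_newton (s : rat) f n : wder f = s *: (totP * f) ->
  n.+1%:R *: hpart n.+1 f = s *: \sum_(i < n.+1) serP i.+1 * hpart (n - i) f.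
Proof.
move=> fE; rewrite -hpart_wder fE.
rewrite -[LHS](_ : s *: hpart n.+1 (totP * f) = _); last first.
  by apply: seriesP => m; rewrite scoefZ /= mulrCA.
rewrite hpartM big_ord_recl hpart0_totP mul0r add0r; congr (_ *: _).
by apply: eq_bigr => i _; rewrite hpart_totP.
Qed.

Lemma serH_newton n :
  n.+1%:R *: serH n.+1 = 1 *: \sum_(i < n.+1) serP i.+1 * serH (n - i).
Proof.
rewrite -hpart_totH (hpart_newton 1) ?wder_totH ?scale1r //.
by apply: eq_bigr => i _; rewrite hpart_totH.
Qed.

Lemma serE_newton n :
  n.+1%:R *: serE n.+1 = -1 *: \sum_(i < n.+1) serP i.+1 * serE (n - i).
Proof.
rewrite -hpart_totE (hpart_newton (-1)) ?wder_totE ?scaleN1r //.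
by congr (- _); apply: eq_bigr => i _; rewrite hpart_totE.
Qed.

(** * Expansions of H and E, and the three identities *)

Lemma csize_single n : csize (single n) = n.
Proof.
rewrite /csize /single; case: insubP => [a _ <-|] /=; first by rewrite big_seq1.
by rewrite big_nil; case: n.
Qed.

(** The condition on [F 0] covers [n = 0], where [single n] is empty. *)
Lemma big_single F n : F 0%N = 1 -> \prod_(a <- single n) F a = F n :> series.
Proof.
rewrite /single => F0; case: insubP => [a _ <-|] /=; first by rewrite big_seq1.
by rewrite big_nil; case: n.
Qed.

Lemma serH_sum_serE n :
  serH n = \sum_(al <- comps n) (-1) ^+ size al *: \prod_(a <- al) serE a.
Proof.
rewrite (inverse_comps _ _ _ serE0 serH0 serE_conv_serH).
apply: eq_bigr => al _.
(* The sign is a series on one side and a rational scalar on the other; both reduce to a parity. *)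
by rewrite -signr_odd -[in RHS]signr_odd scaler_sign mulr_sign.
Qed.

Lemma serE_sum_serH n :
  serE n = \sum_(al <- comps n) (-1) ^+ size al *: \prod_(a <- al) serH a.
Proof.
rewrite (inverse_comps _ _ _ serH0 serE0) => [|k].
  apply: eq_bigr => al _.
  by rewrite -signr_odd -[in RHS]signr_odd scaler_sign mulr_sign.
(* With the roles of E and H exchanged, the convolution is the same sum read backwards. *)
rewrite (reindex_inj rev_ord_inj) -[RHS](serE_conv_serH k); apply: eq_bigr => i _.
by rewrite mulrC /= subSS subKn // -ltnS.
Qed.

Theorem proposition25 (d : nat) :
  [/\ serEplus d = \sum_(de \in PCom_E d)
        ((-1) ^+ size (de one_pos) *: ser_pc serE de),
      serEplus d = \sum_(de \in PCom_H d)
        ((-1) ^+ size (de two_pos) *: ser_pc serH de)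
    & serEplus d = \sum_(de \in PCom_P d)
        ((-1) ^+ size (de two_pos)
          * (1 / ((Zcomp (de one_pos))%:R * (Zcomp (de two_pos))%:R)) *: ser_pc serP de)].
Proof.
have cs n al : al \in comps n -> csize al = n by rewrite mem_comps => /eqP.
have ss n al : al \in [:: single n] -> csize al = n.
  by rewrite inE => /eqP ->; exact: csize_single.
have cu := comps_uniq.
split; rewrite serEplus_conv.
(* Here [serH (d - 2j)] is expanded in E, while [serE j] stays as the single block [j^2]. *)
- rewrite (@sum_poly12 _ comps (fun n => [:: single n]) d) //.
    apply: eq_bigr => j _; rewrite serH_sum_serE big_distrl; apply: eq_bigr => al _.
    rewrite big_seq1 ser_pc_poly12 big_single ?serE0 // poly12E /=.
    by rewrite scalerAl.
  move=> de; split=> [[dE [al [b deE]]]|[al [be [dE _ + ->]]]].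
    exists al, (single b); rewrite mem_comps csize_single inE !eqxx; split=> //.
    by rewrite -dE deE pcsize_poly12 csize_single.
  rewrite inE => /eqP beE; split; first by rewrite pcsize_poly12.
  by exists al, (csize be); rewrite -beE.
(* Here [serE j] is expanded in H inside the substitution, while [serH (d - 2j)] stays as a single
   block. *)
- rewrite (@sum_poly12 _ (fun n => [:: single n]) comps d) //.
    apply: eq_bigr => j _; rewrite serE_sum_serH big_seq1 linear_sum big_distrr.
    apply: eq_bigr => be _.
    by rewrite ser_pc_poly12 big_single ?serH0 // poly12E /= linearZ scalerAr.
  move=> de; split=> [[dE [a [be deE]]]|[al [be [dE + _ ->]]]].
    exists (single a), be; rewrite mem_comps csize_single inE !eqxx; split=> //.
    by rewrite -dE deE pcsize_poly12 csize_single.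
  rewrite inE => /eqP alE; split; first by rewrite pcsize_poly12.
  by exists (csize al), be; rewrite -alE.
rewrite (@sum_poly12 _ comps comps d) //; last first.
  move=> de; split=> [[dE [al [be deE]]]|[al [be [dE _ _ ->]]]].
    by exists al, be; rewrite !mem_comps !eqxx; split; rewrite // -dE deE pcsize_poly12.
  by split; [rewrite pcsize_poly12 | exists al, be].
apply: eq_bigr => j _.
(* Both factors are expanded in P: H with [s = 1], which leaves no sign on [al], and E with
   [s = -1], which gives the sign on [be]. *)
rewrite (newton_comps _ _ _ _ serH0 serH_newton) (newton_comps _ _ _ _ serE0 serE_newton).
rewrite big_distrl; apply: eq_bigr => al _.
rewrite linear_sum big_distrr; apply: eq_bigr => be _.
rewrite ser_pc_poly12 !poly12E /= linearZ -scalerAl -scalerAr scalerA.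
by rewrite expr1n !div1r invfM mulrCA.
Qed.
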